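(* Let $E$ be a directed graph and $R$ a commutative ring with $1$. The relation $$(f_1,g_1)\le(f_2,g_2)\iff f_1(H,S)\subseteq f_2(H,S)\text{ for all }(H,S)\in\mathscr{T}_E^*\text{ and }g_1(c)\subseteq g_2(c)\text{ for all }c\in C_u(E)$$ is a partial order on $\mathscr{D}_{E,R}$. With this partial order, $\mathscr{D}_{E,R}$ forms a lattice, with the meet and join operations given by $$(f_1,g_1)\wedge(f_2,g_2)=(f_1\cap f_2,\ g_1\cap g_2),\qquad (f_1,g_1)\vee(f_2,g_2)=(\overline{f_1+f_2+G_c^+},\ g_1+g_2),$$ where $G_c^+:\mathscr{T}_E^*\to\mathcal{L}(R)$ is the function that maps $(\overline{c^0},\varnothing)$ to $(g_1(c)+g_2(c))\cap R$ for $c\in C_u(E)$, and the rest to the zero ideal.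
   Context: Graphs. A directed graph $E=(E^0,E^1,r,s)$ consists of a set $E^0$ of vertices, a set $E^1$ of edges, and range and source maps $r,s:E^1\to E^0$. A vertex $v$ is an infinite emitter if $s^{-1}(v)$ is infinite, and regular if $s^{-1}(v)$ is finite and nonempty. A path of positive length is a finite sequence $\mu=e_1\cdots e_n$ of edges with $r(e_i)=s(e_{i+1})$, with $s(\mu)=s(e_1)$ and $r(\mu)=r(e_n)$; vertices are paths of length $0$; $\mu^0$ is the set of vertices of $\mu$. A path $e_1\cdots e_n$ with $n>0$ is closed if $s(e_1)=r(e_n)$; a closed path is simple if $s(e_1)=s(e_i)$ implies $i=1$, and a cycle if $s(e_i)=s(e_j)$ implies $i=j$. An exit of $e_1\cdots e_n$ is an edge $e$ such that $s(e)=s(e_i)$ and $e\neq e_i$ for some $i$. For a ring $A$, $\mathcal{L}(A)$ is the set of (two-sided) ideals of $A$. Admissible pairs. A set $H\subseteq E^0$ is hereditary if for every path $\mu$, $s(\mu)\in H$ implies $r(\mu)\in H$; it is saturated if for every regular vertex $v$, $r(s^{-1}(v))\subseteq H$ implies $v\in H$. For $K\subseteq E^0$, $\overline{K}$ is the smallest hereditary saturated subset of $E^0$ containing $K$. A breaking vertex for a hereditary set $H$ is an infinite emitter $v\in E^0\setminus H$ with $0<|s^{-1}(v)\cap r^{-1}(E^0\setminus H)|<\infty$. An admissible pair is a pair $(H,S)$ with $H$ hereditary saturated and $S$ a set of breaking vertices for $H$. The set $\mathscr{T}_E$ of admissible pairs is ordered by $(H_1,S_1)\le(H_2,S_2)$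 iff $H_1\subseteq H_2$ and $S_1\subseteq H_2\cup S_2$; it is a complete lattice, with suprema denoted $\bigvee$. Put $\mathscr{T}_E^*=\mathscr{T}_E\setminus\{(\varnothing,\varnothing)\}$. Saturated functions. $\mathscr{F}_{E,R}$ is the set of functions $f:\mathscr{T}_E^*\to\mathcal{L}(R)$ that satisfy $f\big(\bigvee_{i}(H_i,S_i)\big)=\bigcap_i f(H_i,S_i)$ for all families $\{(H_i,S_i)\}_i$ of admissible pairs in $\mathscr{T}_E^*$; it is ordered by $f_1\le f_2$ iff $f_1(H,S)\subseteq f_2(H,S)$ for all $(H,S)\in\mathscr{T}_E^*$. A function $h:\mathscr{T}_E^*\to\mathcal{L}(R)$ is order-reversing if $(H_1,S_1)\le(H_2,S_2)$ implies $h(H_2,S_2)\subseteq h(H_1,S_1)$. Given an order-reversing function $h:\mathscr{T}_E^*\to\mathcal{L}(R)$, its saturation $\overline{h}$ is the smallest function in $\mathscr{F}_{E,R}$ such that $h(H,S)\subseteq\overline{h}(H,S)$ for all $(H,S)\in\mathscr{T}_E^*$. Sums and intersections of ideal-valued functions with the same domain are taken pointwise. Cycles. Two cycles are equivalent if they contain the same edges in the same cyclic order, possibly with different basepoints. $C_u(E)$ is the set of equivalence classes of cycles $c$ such that there is exactly one closed simple path based at $s(c)=r(c)$; one writes $c\in C_u(E)$ for a representative cycle $c$. For a cycle $c$, $c_\downarrow$ is the hereditary saturated closure of the set of ranges of the exits of $c$. The set $\mathscr{D}_{E,R}$. It is the set of pairs $(f,g)$ where $f\in\mathscr{F}_{E,R}$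 and $g:C_u(E)\to\mathcal{L}(R[x,x^{-1}])$ is a map such that, for every $c\in C_u(E)$, $g(c)\cap R=f(\overline{c^0},\varnothing)$, and $g(c)\subseteq f(c_\downarrow,\varnothing)[x,x^{-1}]$ if $c_\downarrow\neq\varnothing$. Here $J[x,x^{-1}]$ is the set of Laurent polynomials with coefficients in the ideal $J$ of $R$. *)

(* Defs.v *)
From HB Require Import structures.
From Stdlib Require Import List Relation_Definitions.
From mathcomp Require Import all_boot all_order all_algebra finmap zify.
From mathcomp Require Import boolp classical_sets cardinality.

Set Implicit Arguments.
Unset Strict Implicit.
Unset Printing Implicit Defensive.

Import GRing.Theory.
Local Open Scope fset_scope.
Local Open Scope ring_scope.

(* Laurent polynomials over R: p i is the coefficient of x^i. The zero ring is
   allowed for R. *)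
Definition laurent (R : comPzRingType) := {fsfun int -> R with 0}.

HB.instance Definition _ (R : comPzRingType) :=
  Choice.copy (laurent R) {fsfun int -> R with 0}.

Section LaurentRing.
Variable R : comPzRingType.
Implicit Types p q r : laurent R.

Definition laurentC (a : R) : laurent R :=
  [fsfun i in [fset (0 : int)] => a | 0].

Definition laurent_add p q : laurent R :=
  [fsfun i in finsupp p `|` finsupp q => p i + q i | 0].

Definition laurent_opp p : laurent R := [fsfun i in finsupp p => - p i | 0].

Definition laurent_mul p q : laurent R :=
  [fsfun k in [fset i + j | i in finsupp p, j in finsupp q] =>
     \sum_(i <- finsupp p) p i * q (k - i) | 0].

Lemma laurentCE a i : laurentC a i = if i == 0 then a else 0.
Proof. by rewrite fsfunE inE. Qed.

Lemma laurent_addE p q i : laurent_add p q i = p i + q i.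
Proof.
rewrite fsfunE inE; case: (finsuppP p i) => //=; case: (finsuppP q i) => //=.
by rewrite addr0.
Qed.

Lemma laurent_oppE p i : laurent_opp p i = - p i.
Proof. by rewrite fsfunE; case: (finsuppP p i); rewrite ?oppr0. Qed.

Lemma laurent_mulE p q k :
  laurent_mul p q k = \sum_(i <- finsupp p) p i * q (k - i).
Proof.
rewrite fsfunE; case: ifPn => // kN; apply/esym/big1_seq => i /andP[_ ip].
case: (finsuppP q (k - i)) => [|kq]; first by rewrite mulr0.
by case/negP: kN; apply/imfset2P; exists i => //; exists (k - i) => //; rewrite addrC subrK.
Qed.

Lemma laurent_sum_widen p (F : int -> R) (D : seq int) :
    uniq D -> {subset finsupp p <= D} ->
  \sum_(i <- finsupp p) p i * F i = \sum_(i <- D) p i * F i.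
Proof.
move=> uD sD; rewrite [RHS](bigID (mem (finsupp p))) /= [X in _ + X]big1 ?addr0.
  rewrite -[RHS]big_filter; apply: perm_big; apply: uniq_perm; [exact: fset_uniq|exact: filter_uniq|].
  move=> i; rewrite mem_filter; apply/idP/andP => [ip|[]//].
  by split=> //; apply: sD.
by move=> i iN; rewrite fsfun_dflt ?mul0r.
Qed.

Lemma laurent_addA : associative laurent_add.
Proof. by move=> p q r; apply/fsfunP => i; rewrite !laurent_addE addrA. Qed.

Lemma laurent_addC : commutative laurent_add.
Proof. by move=> p q; apply/fsfunP => i; rewrite !laurent_addE addrC. Qed.

Lemma laurent_add0 : left_id (laurentC 0) laurent_add.
Proof.
by move=> p; apply/fsfunP => i; rewrite laurent_addE laurentCE if_same add0r.
Qed.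

Lemma laurent_addN : left_inverse (laurentC 0) laurent_opp laurent_add.
Proof.
move=> p; apply/fsfunP => i.
by rewrite laurent_addE laurent_oppE laurentCE if_same addNr.
Qed.

HB.instance Definition _ := GRing.isZmodule.Build (laurent R)
  laurent_addA laurent_addC laurent_add0 laurent_addN.

Lemma laurent_mulC : commutative laurent_mul.
Proof.
move=> p q; apply/fsfunP => k; rewrite !laurent_mulE.
pose D := undup (finsupp p ++ [seq k - j | j <- finsupp q]).
have uD : uniq D by exact: undup_uniq.
rewrite (laurent_sum_widen (fun i => q (k - i)) uD); last first.
  by move=> i ip; rewrite mem_undup mem_cat ip.
have rK : involutive (fun i : int => k - i).
  by move=> i; rewrite opprB addrC subrK.
have uD' : uniq [seq k - i | i <- D].
  by rewrite map_inj_uniq //; apply: inv_inj.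
rewrite (laurent_sum_widen (fun i => p (k - i)) uD'); last first.
  move=> j jq; apply/mapP; exists (k - j); last by rewrite (rK j).
  by rewrite mem_undup mem_cat; apply/orP; right; apply/mapP; exists j.
by rewrite big_map; apply: eq_bigr => i _; rewrite (rK i) mulrC.
Qed.

Lemma laurent_mulA : associative laurent_mul.
Proof.
move=> p q r; apply/fsfunP => k; rewrite !laurent_mulE.
pose D := undup (finsupp (laurent_mul p q) ++
  [seq i + j | i <- finsupp p, j <- finsupp q]).
have uD : uniq D by exact: undup_uniq.
rewrite (laurent_sum_widen (fun i => r (k - i)) uD); last first.
  by move=> i ip; rewrite mem_undup mem_cat ip.
under [RHS]eq_bigr => i _ do rewrite laurent_mulE mulr_suml.
rewrite exchange_big /=; apply: eq_big_seq => i ip.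
rewrite laurent_mulE mulr_sumr.
have uD' : uniq [seq j - i | j <- D] by rewrite map_inj_uniq //; apply: addIr.
have:= @laurent_sum_widen q (fun j => r (k - i - j)) _ uD'.
rewrite -!mulr_sumr => -> /=; last first.
  move=> j jq; apply/mapP; exists (i + j); last by rewrite addrC addrA addNr add0r.
  by rewrite mem_undup mem_cat; apply/orP; right; apply: allpairs_f.
rewrite big_map mulr_sumr; apply: eq_bigr => j _.
by rewrite mulrA; congr (_ * r _); rewrite opprB addrA subrK.
Qed.

Lemma laurent_mul1 : left_id (laurentC 1) laurent_mul.
Proof.
move=> p; apply/fsfunP => k; rewrite laurent_mulE.
rewrite (@laurent_sum_widen (laurentC 1) (fun i => p (k - i)) [:: 0]) //.
  by rewrite big_seq1 laurentCE eqxx mul1r subr0.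
move=> i; rewrite mem_finsupp laurentCE inE.
by case: ifP => //; rewrite eqxx.
Qed.

Lemma laurent_mulDl : left_distributive laurent_mul +%R.
Proof.
move=> p q r; apply/fsfunP => k.
rewrite [RHS]laurent_addE !laurent_mulE.
pose D := undup (finsupp (p + q) ++ finsupp p ++ finsupp q).
have uD : uniq D by exact: undup_uniq.
rewrite !(laurent_sum_widen (fun i => r (k - i)) uD);
  try by move=> i ip; rewrite mem_undup !mem_cat ip ?orbT.
by rewrite -big_split; apply: eq_bigr => i _; rewrite laurent_addE mulrDl.
Qed.

HB.instance Definition _ := GRing.Zmodule_isComPzRing.Build (laurent R)
  laurent_mulA laurent_mulC laurent_mul1 laurent_mulDl.

End LaurentRing.

Local Close Scope fset_scope.
Local Open Scope classical_set_scope.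

Local Obligation Tactic := idtac.

Section Ideals.
Variable A : comPzRingType.

Record ideal := Ideal {
  ideal_set :> set A;
  ideal0 : ideal_set 0;
  idealD : forall a b, ideal_set a -> ideal_set b -> ideal_set (a + b);
  idealM : forall a b, ideal_set b -> ideal_set (a * b) }.

Lemma ideal_eq (I J : ideal) : (I : set A) = J -> I = J.
Proof.
case: I J => [I I0 ID IM] [J J0 JD JM] /= IJ; subst J.
by congr Ideal; apply: Prop_irrelevance.
Qed.

Program Definition ideal_zero : ideal := @Ideal [set 0] _ _ _.
Next Obligation. by []. Qed.
Next Obligation. by move=> a b /= -> ->; rewrite addr0. Qed.
Next Obligation. by move=> a b /= ->; rewrite mulr0. Qed.

Program Definition ideal_add (I J : ideal) : ideal :=
  @Ideal [set x | exists a b, [/\ ideal_set I a, ideal_set J b & x = a + b]] _ _ _.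
Next Obligation.
by move=> I J; exists 0, 0; rewrite addr0; split=> //; apply: ideal0.
Qed.
Next Obligation.
move=> I J x y [a [b [Ia Jb ->]]] [c [d [Ic Jd ->]]].
by exists (a + c), (b + d); rewrite addrACA; split=> //; apply: idealD.
Qed.
Next Obligation.
move=> I J x y [a [b [Ia Jb ->]]].
by exists (x * a), (x * b); rewrite mulrDr; split=> //; apply: idealM.
Qed.

Program Definition ideal_bigcap (F : set ideal) : ideal :=
  @Ideal (\bigcap_(I in F) I) _ _ _.
Next Obligation. by move=> F I FI; apply: ideal0. Qed.
Next Obligation. by move=> F a b Fa Fb I FI; apply: idealD; auto. Qed.
Next Obligation. by move=> F a b Fb I FI; apply: idealM; auto. Qed.

Program Definition ideal_cap (I J : ideal) : ideal := @Ideal (I `&` J) _ _ _.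
Next Obligation. by move=> I J; split; apply: ideal0. Qed.
Next Obligation. by move=> I J a b [Ia Ja] [Ib Jb]; split; apply: idealD. Qed.
Next Obligation. by move=> I J a b [Ib Jb]; split; apply: idealM. Qed.

End Ideals.

Section LaurentIdeals.
Variable R : comPzRingType.

Lemma laurentCD (a b : R) : laurentC (a + b) = laurentC a + laurentC b.
Proof.
apply/fsfunP => i; rewrite laurent_addE !laurentCE.
by case: ifP; rewrite ?addr0.
Qed.

Lemma laurentCM (a b : R) : laurentC (a * b) = laurentC a * laurentC b.
Proof.
apply/fsfunP => k; rewrite [RHS]laurent_mulE.
rewrite (@laurent_sum_widen _ (laurentC a) (fun i => laurentC b (k - i)) [:: 0]) //.
  by rewrite big_seq1 subr0 !laurentCE eqxx; case: ifP; rewrite ?mulr0.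
move=> i; rewrite mem_finsupp laurentCE inE.
by case: ifP => //; rewrite eqxx.
Qed.

(* J ∩ R, for R embedded in R[x,x^-1] as the constants *)
Program Definition ideal_contract (J : ideal (laurent R)) : ideal R :=
  @Ideal R [set a | ideal_set J (laurentC a)] _ _ _.
Next Obligation. by move=> J; exact: (ideal0 J). Qed.
Next Obligation. by move=> J a b /= Ja Jb; rewrite laurentCD; apply: idealD. Qed.
Next Obligation. by move=> J a b /= Jb; rewrite laurentCM; apply: idealM. Qed.

(* I[x,x^-1] *)
Definition laurent_over (I : set R) : set (laurent R) :=
  [set p | forall i : int, I (p i)].

End LaurentIdeals.

Record digraph := Digraph {
  vertex : Type;
  edge : Type;
  src : edge -> vertex;
  rng : edge -> vertex }.

Section Graph.
Variable E : digraph.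
Local Notation V := (vertex E).
Local Notation edges := (seq (edge E)).
Implicit Types (u v w : V) (e : edge E) (mu c d : edges) (H K S : set V).

(* A path is given by its source v and its list of edges; the paths of length
   0 are those with empty list. *)
Fixpoint is_path v mu : Prop :=
  if mu is e :: mu' then src e = v /\ is_path (rng e) mu' else True.

Definition path_rng v mu : V := last v [seq rng e | e <- mu].

Definition closed_path v mu :=
  [/\ mu <> [::], is_path v mu & path_rng v mu = v].

Definition closed_simple_path v mu := closed_path v mu /\
  forall i, (i < size mu)%N -> nth v [seq src e | e <- mu] i = v -> i = 0%N.

Definition is_cycle v c := closed_path v c /\
  forall i j, (i < size c)%N -> (j < size c)%N ->
    nth v [seq src e | e <- c] i = nth v [seq src e | e <- c] j -> i = j.

Definition path_vertices mu : set V :=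
  [set v | exists2 e, List.In e mu & v = src e \/ v = rng e].

Definition exits mu : set (edge E) :=
  [set e | exists2 f, List.In f mu & src e = src f /\ e <> f].

Definition emitted v : set (edge E) := [set e | src e = v].

Definition infinite_emitter v := infinite_set (emitted v).

Definition regular v := finite_set (emitted v) /\ emitted v !=set0.

Definition hereditary H :=
  forall v mu, is_path v mu -> H v -> H (path_rng v mu).

Definition saturated H :=
  forall v, regular v -> (forall e, emitted v e -> H (rng e)) -> H v.

Definition hs_closure K : set V :=
  \bigcap_(H in [set H | [/\ hereditary H, saturated H & K `<=` H]]) H.

Lemma hs_closure_hereditary K : hereditary (hs_closure K).
Proof.
by move=> v mu vmu Kv H HH; have [hH _ _] := HH; apply: hH => //; apply: Kv.
Qed.

Lemma hs_closure_saturated K : saturated (hs_closure K).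
Proof.
move=> v rv Kv H HH; have [_ sH _] := HH.
by apply: sH => // e ve; apply: Kv.
Qed.

Lemma sub_hs_closure K : K `<=` hs_closure K.
Proof. by move=> v Kv H [_ _ KH]; apply: KH. Qed.

Definition breaking H v :=
  [/\ infinite_emitter v, ~ H v,
      emitted v `&` [set e | ~ H (rng e)] !=set0 &
      finite_set (emitted v `&` [set e | ~ H (rng e)])].

Record admissible := Admissible {
  adm_H : set V;
  adm_S : set V;
  adm_hereditary : hereditary adm_H;
  adm_saturated : saturated adm_H;
  adm_breaking : adm_S `<=` breaking adm_H }.

Definition adm_le (x y : admissible) :=
  adm_H x `<=` adm_H y /\ adm_S x `<=` adm_H y `|` adm_S y.

(* Admissible pairs other than the pair of empty sets. *)
Record admissible_nz := AdmissibleNz {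
  adm_of :> admissible;
  adm_nz : ~ (adm_H adm_of = set0 /\ adm_S adm_of = set0) }.

(* The pair (H, empty set). *)
Program Definition adm_of_set H (hH : hereditary H) (sH : saturated H)
    (H0 : H !=set0) : admissible_nz :=
  @AdmissibleNz (@Admissible H set0 hH sH _) _.
Next Obligation. by move=> H *; apply: sub0set. Qed.
Next Obligation. by move=> H hH sH [v Hv] [/= H0 _]; rewrite H0 in Hv. Qed.

(* Same edges in the same cyclic order, with a possibly different basepoint. *)
Definition cycle_equiv c d := exists n, d = rot n c.

Definition only_cycle c :=
  exists2 v, is_cycle v c & exists! mu, closed_simple_path v mu.

Record Cu := MkCu {
  Cu_class : set edges;
  Cu_classP : exists c, only_cycle c /\ Cu_class = [set d | cycle_equiv c d] }.

Definition Cu_repr (C : Cu) : edges := sval (cid (Cu_classP C)).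

Lemma Cu_reprP (C : Cu) : only_cycle (Cu_repr C) /\
  Cu_class C = [set d | cycle_equiv (Cu_repr C) d].
Proof. exact: (svalP (cid (Cu_classP C))). Qed.

Lemma Cu_vertices_nonempty (C : Cu) :
  hs_closure (path_vertices (Cu_repr C)) !=set0.
Proof.
have [[v [[+ _ _] _] _] _] := Cu_reprP C.
case: (Cu_repr C) => // e mu _; exists (src e); apply: sub_hs_closure.
by exists e; [left | left].
Qed.

Definition Cu_pair (C : Cu) : admissible_nz :=
  adm_of_set (@hs_closure_hereditary _) (@hs_closure_saturated _)
    (Cu_vertices_nonempty C).

Definition Cu_down (C : Cu) : set V :=
  hs_closure (@rng E @` exits (Cu_repr C)).

Definition Cu_down_pair (C : Cu) (C0 : Cu_down C !=set0) : admissible_nz :=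
  adm_of_set (@hs_closure_hereditary _) (@hs_closure_saturated _) C0.

Lemma is_path_cat v mu1 mu2 :
  is_path v (mu1 ++ mu2) <-> is_path v mu1 /\ is_path (path_rng v mu1) mu2.
Proof.
elim: mu1 v => [|e mu1 IH] v /=; first by split=> [|[]].
by rewrite IH /path_rng /=; split=> [[? [? ?]]|[[? ?] ?]].
Qed.

Lemma path_rng_cat v mu1 mu2 :
  path_rng v (mu1 ++ mu2) = path_rng (path_rng v mu1) mu2.
Proof. by rewrite /path_rng map_cat last_cat. Qed.

Lemma in_path_split e mu : List.In e mu -> exists a b, mu = a ++ e :: b.
Proof. exact: List.in_split. Qed.

Lemma hs_closure_reaches K c v : closed_path v c -> hs_closure K v ->
  exists k mu, [/\ K k, is_path k mu & path_rng k mu = v].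
Proof.
move=> [c0 vc cv] Kv; apply: contrapT => nK.
pose X : set V := [set u | ~ exists2 mu, is_path u mu & path_rng u mu = v].
suff /(_ _ Kv) : hs_closure K `<=` X by apply; exists [::].
move=> u; apply; split.
- move=> w mu wmu Xw [nu wnu nuv]; apply: Xw; exists (mu ++ nu).
    by apply/is_path_cat.
  by rewrite path_rng_cat.
- move=> w [_ [e we]] Xw [[|f mu] /=].
    move=> _; rewrite /path_rng /= => wv; subst w.
    case: c c0 vc cv => // g c _ [gv gc] cg.
    by apply: (Xw g gv); exists c.
  by move=> [fw fmu] muv; apply: (Xw f fw); exists mu.
- by move=> k Kk [mu kmu muv]; apply: nK; exists k, mu.
Qed.

Lemma path_first_return u v mu : mu <> [::] -> is_path u mu ->
    path_rng u mu = v ->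
  exists a b, [/\ mu = a ++ b, a <> [::], is_path u a, path_rng u a = v &
    [/\ is_path v b, path_rng v b = v &
     forall i, (i < size a)%N -> nth v [seq src e | e <- a] i = v -> i = 0%N]].
Proof.
elim: mu u => // e mu IH u _ /= [eu emu] muv.
have [ev|nev] := pselect (rng e = v).
  exists [:: e], mu; split=> //; split; first by rewrite -ev.
  - by move: muv; rewrite /path_rng /= ev.
  - by case.
have mu0 : mu <> [::] by move=> m0; apply: nev; move: muv; rewrite m0.
have [a [b [mab a0 ea av [vb bv ab]]]] := IH _ mu0 emu muv.
exists (e :: a), b; split=> //; first by rewrite mab.
split=> // -[|i] //= ia iv; have i0 := ab i ia iv.
by case: a a0 ea iv {ab ia mab av} => // f a _ [fe _]; rewrite i0 /= fe.
Qed.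

Lemma closed_path_sub v c mu : closed_path v mu ->
    (forall nu, closed_simple_path v nu -> nu = c) ->
  forall e, List.In e mu -> List.In e c.
Proof.
move=> + uc; have [n] := ubnP (size mu); elim: n mu => // n IH mu.
rewrite ltnS => mun [mu0 vmu muv] e.
have [a [b [mab a0 va av [vb bv ab]]]] := path_first_return mu0 vmu muv.
have ac : a = c by apply: uc.
rewrite mab => emab; have [|eb] := List.in_app_or _ _ _ emab; first by rewrite ac.
apply: (IH b) => //.
  apply: leq_trans mun; rewrite mab size_cat -[X in (X < _)%N]add0n ltn_add2r.
  by case: (a) a0.
by split=> // b0; rewrite b0 in eb.
Qed.

Lemma path_vertices_reach v c w : closed_path v c -> path_vertices c w ->
  exists2 mu, is_path v mu & path_rng v mu = w.
Proof.
move=> [_ vc _] [e /in_path_split[a [b cab]] ew]; rewrite cab in vc.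
have /is_path_cat[va [ea eb]] := vc.
case: ew => ->; first by exists a.
exists (a ++ [:: e]); first by apply/is_path_cat.
by rewrite path_rng_cat.
Qed.

Lemma is_cycle_rot v v' c : is_cycle v c -> path_vertices c v' ->
  exists n, is_cycle v' (rot n c).
Proof.
move=> [[c0 vc cv] uc] cv'.
have [a [b [cab va av' b0]]] :
    exists a b, [/\ c = a ++ b, is_path v a, path_rng v a = v' & b <> [::]].
  have [e /in_path_split[a [b cab]] ew] := cv'.
  have vc' := vc; rewrite cab in vc'; have /is_path_cat[va [ea eb]] := vc'.
  case: ew => ->; first by exists a, (e :: b).
  case: b cab eb {vc'} => [|f b] cab eb.
    by exists [::], c; split=> //; rewrite -cv cab path_rng_cat.
  exists (a ++ [:: e]), (f :: b); split=> //; first by rewrite -catA.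
  - exact/is_path_cat.
  - by rewrite path_rng_cat.
have vc' := vc; rewrite cab in vc'; have /is_path_cat[_ vb] := vc'.
rewrite av' in vb.
have bv : path_rng v' b = v by rewrite -cv cab path_rng_cat av'.
exists (size a); rewrite cab rot_size_cat; split.
  split; first by case: b b0 {cab vb bv vc'}.
  - by apply/is_path_cat; rewrite bv.
  - by rewrite path_rng_cat bv.
have shift i : (i < size (b ++ a))%N -> exists i', [/\ (i' < size c)%N,
    nth v' [seq src e | e <- b ++ a] i = nth v [seq src e | e <- c] i' &
    i' = (if (i < size b)%N then size a + i else i - size b)%N].
  move=> ilt; exists (if (i < size b)%N then size a + i else i - size b)%N.
  rewrite cab !map_cat !nth_cat !size_map; move: ilt; rewrite !size_cat => ilt.
  have [ib|ib] := ltnP i (size b); split=> //.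
  - by rewrite ltn_add2l.
  - rewrite ltnNge leq_addr /= addKn; apply: set_nth_default.
    by rewrite size_map.
  - lia.
  - have ia : (i - size b < size a)%N by lia.
    by rewrite ia; apply: set_nth_default; rewrite size_map.
move=> i j /[dup] ib /shift[i' [ic -> ii']] /[dup] jb /shift[j' [jc -> jj']].
move=> /(uc _ _ ic jc); rewrite ii' jj'; move: ib jb; rewrite size_cat.
by have [] := ltnP i (size b); have [] := ltnP j (size b); lia.
Qed.

Lemma is_cycle_simple v c : is_cycle v c -> closed_simple_path v c.
Proof.
move=> [cc uc]; split=> // i ic iv; case: cc => c0 vc _.
have c_gt0 : (0 < size c)%N by case: (c) c0.
by apply: uc => //; rewrite iv; case: (c) c0 vc => //= e mu _ [].
Qed.

Lemma cycle_equiv_rot_rot c m n : cycle_equiv c (rot m (rot n c)).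
Proof.
have small k d : exists2 l, (l <= size d)%N & rot k d = rot l d.
  have [dk|kd] := leqP (size d) k; last by exists k => //; apply: ltnW.
  by exists 0%N; rewrite ?rot0 ?rot_oversize.
have [n' nc ->] := small n c; have [m' +  ->] := small m (rot n' c).
by rewrite size_rot => mc; rewrite rot_add_mod //; eexists.
Qed.

Lemma Cu_pair_inj : injective Cu_pair.
Proof.
move=> C C' /(congr1 (fun x : admissible_nz => adm_H x)) /= eqH.
have [[v cc [c0 [_ uc]]] defC] := Cu_reprP C.
have [[v' cc' [c0' [_ uc']]] defC'] := Cu_reprP C'.
set c := Cu_repr C in eqH cc defC; set c' := Cu_repr C' in eqH cc' defC'.
have on_cycle w d : is_cycle w d -> path_vertices d w.
  by move=> [[+ + _] _]; case: d => // e d _ [ew _]; exists e; [left | left].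
have link w w' d d' : is_cycle w d -> is_cycle w' d' ->
    hs_closure (path_vertices d) = hs_closure (path_vertices d') ->
    exists2 mu, is_path w mu & path_rng w mu = w'.
  move=> dd dd' eqd; have [k [mu [kd kmu muw]]] :
      exists k mu, [/\ path_vertices d k, is_path k mu & path_rng k mu = w'].
    apply: (hs_closure_reaches dd'.1); rewrite eqd.
    by apply: sub_hs_closure; apply: on_cycle.
  have [nu wnu nuk] := path_vertices_reach dd.1 kd.
  exists (nu ++ mu); first by apply/is_path_cat; rewrite nuk.
  by rewrite path_rng_cat nuk.
have [mu vmu muv'] := link _ _ _ _ cc cc' eqH.
have [nu v'nu nuv] := link _ _ _ _ cc' cc (esym eqH).
have [e ec' ev'] : exists2 e, List.In e c' & src e = v'.
  case: (c') cc' => [[[] //]|e d [[_ [ev' _] _] _]].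
  by exists e; [left|].
have cl : closed_path v (mu ++ c' ++ nu).
  have [[c'0 v'c' c'v'] _] := cc'; split.
  - by case: (mu) => //; case: (c') c'0.
  - by rewrite !is_path_cat muv' c'v'.
  - by rewrite !path_rng_cat muv' c'v'.
have cE : c0 = c by apply: uc; apply: is_cycle_simple.
have cv' : path_vertices c v'.
  exists e; last by left.
  apply: (closed_path_sub cl) => [rho /uc <- //|].
  by apply/List.in_or_app; right; apply/List.in_or_app; left.
have [n cn] := is_cycle_rot cc cv'.
have c'E : c' = rot n c.
  by rewrite -(uc' _ (is_cycle_simple cn)) (uc' _ (is_cycle_simple cc')).
have CC' : Cu_class C = Cu_class C'.
  rewrite defC defC' c'E; apply/seteqP; split=> d [m ->].
  - rewrite -[X in rot m X](rotK n c) /rotr; exact: cycle_equiv_rot_rot.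
  - exact: cycle_equiv_rot_rot.
by case: C C' CC' {eqH defC defC' c c' cc cc' uc uc' c0 c0' cl cE cv' cn c'E ec'}
  => [? ?] [? ?] /= CC'; subst; congr MkCu; apply: Prop_irrelevance.
Qed.

End Graph.

Definition is_lub (T : Type) (le : T -> T -> Prop) (A : set T) (m : T) :=
  (forall a, A a -> le a m) /\
  forall b, (forall a, A a -> le a b) -> le m b.

Definition is_glb (T : Type) (le : T -> T -> Prop) (A : set T) (m : T) :=
  is_lub (fun x y => le y x) A m.

Section SaturatedFunctions.
Variables (E : digraph) (R : comPzRingType).
Implicit Types (f h : admissible_nz E -> ideal R).
Implicit Types (g : Cu E -> ideal (laurent R)).

(* Suprema are taken in the lattice of all admissible pairs. The supremum of
   the empty family is the pair of empty sets, so an empty I imposes nothing. *)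
Definition saturated_fun f :=
  forall (I : Type) (x : I -> admissible_nz E) (y : admissible_nz E),
    is_lub (@adm_le E) [set adm_of (x i) | i in [set: I]] (adm_of y) ->
    f y = ideal_bigcap [set f (x i) | i in [set: I]].

(* The least saturated function above h. It exists for every h, order-reversing
   or not: see saturationP. *)
Definition saturation h : admissible_nz E -> ideal R := fun x =>
  ideal_bigcap
    [set f x | f in [set f | saturated_fun f /\ forall y, h y `<=` f y]].

Lemma saturationP h :
  [/\ saturated_fun (saturation h), forall x, h x `<=` saturation h x &
      forall f, saturated_fun f -> (forall x, h x `<=` f x) ->
        forall x, saturation h x `<=` f x].
Proof.
split.
- move=> I x y xy; apply: ideal_eq; apply/seteqP; split=> a.
    move=> ya _ [i _ <-] _ [f [sf hf] <-].
    have : ideal_set (f y) a by apply: ya; exists f.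
    by rewrite (sf _ _ _ xy); apply; exists i.
  move=> xa _ [f [sf hf] <-]; rewrite (sf _ _ _ xy) => _ [i _ <-].
  have xia : ideal_set (saturation h (x i)) a by apply: xa; exists i.
  by apply: xia; exists f.
- by move=> x a ha _ [f [_ hf] <-]; apply: hf.
- by move=> f sf hf x a; apply; exists f.
Qed.

Definition fun_pair : Type :=
  (admissible_nz E -> ideal R) * (Cu E -> ideal (laurent R)).

Definition in_D (p : fun_pair) :=
  saturated_fun p.1 /\
  forall C : Cu E,
    ideal_contract (p.2 C) = p.1 (Cu_pair C) /\
    forall C0 : Cu_down C !=set0,
      p.2 C `<=` laurent_over (p.1 (Cu_down_pair C0)).

Definition D_set := {p | in_D p}.

Definition D_le (p q : D_set) :=
  (forall x, (sval p).1 x `<=` (sval q).1 x) /\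
  (forall C, (sval p).2 C `<=` (sval q).2 C).

(* The choice of C is immaterial, Cu_pair being injective: see G_plus_Cu_pair. *)
Definition G_plus g1 g2 : admissible_nz E -> ideal R := fun x =>
  if pselect (exists C, Cu_pair C = x) is left xP then
    ideal_contract (ideal_add (g1 (sval (cid xP))) (g2 (sval (cid xP))))
  else ideal_zero R.

Definition D_meet (p q : fun_pair) : fun_pair :=
  (fun x => ideal_cap (p.1 x) (q.1 x), fun C => ideal_cap (p.2 C) (q.2 C)).

Definition D_join (p q : fun_pair) : fun_pair :=
  (saturation (fun x =>
     ideal_add (ideal_add (p.1 x) (q.1 x)) (G_plus p.2 q.2 x)),
   fun C => ideal_add (p.2 C) (q.2 C)).

Lemma G_plus_Cu_pair g1 g2 C :
  G_plus g1 g2 (Cu_pair C) = ideal_contract (ideal_add (g1 C) (g2 C)).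
Proof.
rewrite /G_plus; case: pselect => [CP|[]]; last by exists C.
by have /Cu_pair_inj -> := svalP (cid CP).
Qed.

End SaturatedFunctions.

(* Main.v *)
(** The delicate point is that saturating [f1 + f2 + G_plus] does not enlarge
    its value [J] at the pair [P] of a cycle [c]. The function equal to [J] at
    the pairs above [P] and to the whole ring elsewhere is saturated: if no
    member of a family contains the basepoint [v] of [c], then the vertices not
    leading to [v], with all their breaking vertices, form an upper bound, so
    the supremum misses [v] too. It dominates [f1 + f2 + G_plus] because any
    other cycle [d] whose pair is above [P] satisfies [P <= d_down], so that
    the constant terms of [g1 d + g2 d] lie in [f1 P + f2 P]. *)
Require Import Defs.
From Stdlib Require Import Relation_Definitions.
From mathcomp Require Import all_boot all_algebra finmap.
From mathcomp Require Import boolp classical_sets cardinality.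
Local Open Scope classical_set_scope.

Set Implicit Arguments.
Unset Strict Implicit.
Unset Printing Implicit Defensive.

(** * Admissible pairs, closed paths and their exits *)

Section AdmissiblePairs.
Variable E : digraph.
Local Notation V := (vertex E).
Implicit Types (u v w : V) (H K : set V) (x y : admissible E).

Lemma hs_closure_min K H :
  hereditary H -> saturated H -> K `<=` H -> hs_closure K `<=` H.
Proof. by move=> hH sH KH v; apply. Qed.

Lemma adm_le_refl x : adm_le x x.
Proof. by split=> // v; right. Qed.

Lemma admissible_nz_eq (x y : admissible_nz E) :
  adm_H x = adm_H y -> adm_S x = adm_S y -> x = y.
Proof.
case: x y => [[H S h s b] nx] [[H' S' h' s' b'] ny] /= HH' SS'; subst H' S'.
rewrite (Prop_irrelevance h' h) (Prop_irrelevance s' s).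
rewrite (Prop_irrelevance b' b) in ny *.
by congr AdmissibleNz; apply: Prop_irrelevance.
Qed.

(** This is the largest hereditary set that misses [v]. *)
Definition not_reaching v : set V :=
  [set u | ~ exists2 mu, is_path u mu & path_rng u mu = v].

Lemma not_reaching_hereditary v : hereditary (not_reaching v).
Proof.
move=> w mu wmu Xw [nu wnu nuv]; apply: Xw; exists (mu ++ nu).
  by apply/is_path_cat.
by rewrite path_rng_cat.
Qed.

(** The closed path matters when [u] is [v] itself: the path of length 0 has no first edge, and the
    first edge of [c] takes its place. *)
Lemma reaching_edge v c u : closed_path v c -> ~ not_reaching v u ->
  exists2 e, src e = u & ~ not_reaching v (rng e).
Proof.
move=> [c0 vc cv] /contrapT[[|e mu] /=].
  move=> _; rewrite /path_rng /= => uv; subst u.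
  case: c c0 vc cv => // e c _ [ev ec] cv.
  by exists e => //; apply; exists c.
by move=> [eu emu] muv; exists e => //; apply; exists mu.
Qed.

Lemma not_reaching_saturated v c : closed_path v c ->
  saturated (not_reaching v).
Proof.
move=> vc u _ Xu; apply: contrapT => /(reaching_edge vc)[e eu].
by apply; apply: Xu.
Qed.

Lemma adm_lub_closed_path (I : Type) (x : I -> admissible E) y v c :
  closed_path v c -> is_lub (@adm_le E) [set x i | i in [set: I]] y ->
  adm_H y v -> exists i, adm_H (x i) v.
Proof.
move=> vc [_ ymin] yv; apply: contrapT => nxv.
pose b := Admissible (@not_reaching_hereditary v) (not_reaching_saturated vc)
  (@subset_refl _ (breaking (not_reaching v))).
have sub i : adm_H (x i) `<=` not_reaching v.
  move=> u xu [mu umu muv]; apply: nxv; exists i; rewrite -muv.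
  exact: (adm_hereditary umu).
have /ymin[yb _] : forall a, [set x i | i in [set: I]] a -> adm_le a b.
  move=> _ [i _ <-]; split=> [|u xu]; first exact: sub.
  (* If [u] leads to [v], it breaks [not_reaching v]: [reaching_edge] gives one edge that still
     leads to [v], and all such edges are among the finitely many whose range is outside the smaller
     set [adm_H (x i)]. *)
  have [inf _ _ fin] := adm_breaking xu.
  have [Xu|Xu] := pselect (not_reaching v u); [by left | right].
  split=> //; first by have [e eu Xe] := reaching_edge vc Xu; exists e.
  by apply: sub_finite_set fin => e [eu Xe]; split=> // /sub.
by apply: (yb v yv); exists [::].
Qed.

(** Thus the pair of a cycle lies below an admissible pair as soon as the first component of the
    latter contains the basepoint. *)
Lemma closed_path_hs_closure v c H : closed_path v c ->
  hereditary H -> saturated H -> H v -> hs_closure (path_vertices c) `<=` H.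
Proof.
move=> vc hH sH Hv; apply: hs_closure_min => // w.
by move=> /(path_vertices_reach vc)[mu vmu <-]; apply: hH.
Qed.

Lemma src_path_vertices v c : closed_path v c -> path_vertices c v.
Proof. by case: c => [[]//|e c [_ [ev _] _]]; exists e; left. Qed.

Lemma path_vertices_src v c u : closed_path v c -> path_vertices c u ->
  exists2 f, List.In f c & src f = u.
Proof.
move=> [c0 vc cv] [e ec [->|->]]; first by exists e.
have [a [b cab]] := in_path_split ec.
have := vc; rewrite {1}cab => /is_path_cat[_ [_]].
(* After the last edge the path is back at [v], the source of its first edge; after any other edge,
   the next edge serves. *)
case: b cab => [|f b] cab.
  have -> : rng e = v by rewrite -cv cab path_rng_cat.
  by case: (c) c0 vc => // f d _ [fv _]; exists f; first by left.
move=> [fe _]; exists f => //; rewrite cab.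
by apply/List.in_or_app; right; right; left.
Qed.

(** Follow [mu] while it uses edges of [c]. The first deviation is an exit, and from its range on
    heredity keeps the path inside the closure. *)
Lemma path_from_closed_path v c u mu : closed_path v c ->
  path_vertices c u -> is_path u mu ->
  path_vertices c (path_rng u mu) \/
  hs_closure (@rng E @` exits c) (path_rng u mu).
Proof.
move=> vc; elim: mu u => [|e mu IH] u cu /=; first by left.
move=> [eu emu]; have [f fc fu] := path_vertices_src vc cu.
have [ef|ef] := pselect (e = f); first by apply: IH => //; exists e; [rewrite ef|right].
right; apply: (hs_closure_hereditary emu); apply: sub_hs_closure.
by exists e => //; exists f => //; rewrite eu fu.
Qed.

Lemma Cu_repr_closed (C : Cu E) : exists v, closed_path v (Cu_repr C).
Proof. by have [[v [vc _] _] _] := Cu_reprP C; exists v. Qed.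

Lemma Cu_pair_le (C C' : Cu E) : adm_le (Cu_pair C) (Cu_pair C') ->
  Cu_pair C' = Cu_pair C \/
  exists C0 : Cu_down C' !=set0, adm_le (Cu_pair C) (Cu_down_pair C0).
Proof.
move=> [/= sCC' _]; have [v vc] := Cu_repr_closed C.
have [v' vc'] := Cu_repr_closed C'.
have C'v : hs_closure (path_vertices (Cu_repr C')) v.
  exact: sCC' (sub_hs_closure (src_path_vertices vc)).
have [k [mu [kC' kmu muv]]] := hs_closure_reaches vc C'v.
have [] := path_from_closed_path vc' kC' kmu; rewrite muv => vC'.
  left; apply: admissible_nz_eq => //=; apply/seteqP; split=> //.
  have [f fC' fv] := path_vertices_src vc' vC'.
  (* Now [v] lies on the second cycle, whose remaining edges lead from [v] back to [v']; so [v'] is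
     in the closure of the first cycle and the two closures agree. *)
  have [nu [vnu nuv']] : exists nu, is_path v nu /\ path_rng v nu = v'.
    have [a [b cab]] := in_path_split fC'; have [_] := vc'.
    rewrite cab => /is_path_cat[_ [_ fb]] bv'.
    by exists (f :: b); split=> //; rewrite -bv' path_rng_cat.
  apply: (closed_path_hs_closure vc'); [exact: hs_closure_hereditary|
    exact: hs_closure_saturated|].
  rewrite -nuv'; apply: (hs_closure_hereditary vnu).
  exact: sub_hs_closure (src_path_vertices vc).
right; exists (ex_intro _ v vC'); split=> //=.
apply: (closed_path_hs_closure vc) => //; [exact: hs_closure_hereditary|
  exact: hs_closure_saturated].
Qed.

End AdmissiblePairs.

(** * Sums of ideals *)

Section IdealOperations.
Variable A : comPzRingType.
Implicit Types I J K : ideal A.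

Program Definition ideal_full : ideal A := @Ideal A setT _ _ _.

Lemma ideal_addl I J : I `<=` ideal_add I J.
Proof.
by move=> a Ia; exists a, 0%R; rewrite GRing.addr0; split=> //; apply: ideal0.
Qed.

Lemma ideal_addr I J : J `<=` ideal_add I J.
Proof.
by move=> a Ja; exists 0%R, a; rewrite GRing.add0r; split=> //; apply: ideal0.
Qed.

Lemma ideal_add_sub I J K : I `<=` K -> J `<=` K -> ideal_add I J `<=` K.
Proof.
by move=> IK JK _ [a [b [Ia Jb ->]]]; apply: idealD; [apply: IK|apply: JK].
Qed.

End IdealOperations.

(** * Saturated functions, meets and joins *)

Section Lattice.
Variables (E : digraph) (R : comPzRingType).
Implicit Types (f : admissible_nz E -> ideal R) (x y : admissible_nz E).
Implicit Types (p q : D_set E R).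

(** When [x] is below [y], the supremum of [x] and [y] is [y], so [f y] is the intersection of [f x]
    and [f y]. *)
Lemma saturated_fun_anti f x y : saturated_fun f -> adm_le x y ->
  f y `<=` f x.
Proof.
move=> sf xy; rewrite (sf bool (fun b => if b then x else y) y).
  by move=> a; apply; exists true.
split=> [_ [[] _ <-] // |b]; first exact: adm_le_refl.
by apply; exists false.
Qed.

Definition step_fun x (J : ideal R) : admissible_nz E -> ideal R :=
  fun y => if pselect (adm_le x y) then J else ideal_full R.

Lemma step_fun_saturated (C : Cu E) J : saturated_fun (step_fun (Cu_pair C) J).
Proof.
move=> I x y xy; have [v vc] := Cu_repr_closed C.
apply: ideal_eq; apply/seteqP; split=> a.
  move=> ya _ [i _ <-]; move: ya; rewrite /step_fun.
  case: (pselect (adm_le _ (x i))) => //= -[Px _]; case: pselect => //= -[].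
  have [xy' _] : adm_le (x i) y by apply: xy.1; exists i.
  by split=> //; apply: subset_trans Px xy'.
move=> xa; rewrite /step_fun; case: pselect => //= Py.
(* Since [y] contains the basepoint, so does some member [x i]; that member is then above the
   cycle's pair, and the step function equals [J] there. *)
have yv : adm_H y v by exact: Py.1 _ (sub_hs_closure (src_path_vertices vc)).
have [i xv] := adm_lub_closed_path vc xy yv.
have : ideal_set (step_fun (Cu_pair C) J (x i)) a by apply: xa; exists i.
rewrite /step_fun; case: pselect => //= -[]; split=> //.
exact: (closed_path_hs_closure vc (@adm_hereditary _ _) (@adm_saturated _ _)).
Qed.

Lemma Cu_pair_le_contract p q (C C' : Cu E) :
  adm_le (Cu_pair C) (Cu_pair C') ->
  ideal_contract (ideal_add ((sval p).2 C') ((sval q).2 C')) `<=`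
  ideal_contract (ideal_add ((sval p).2 C) ((sval q).2 C)).
Proof.
case: p q => [[f1 g1] [/= sf1 D1]] [[f2 g2] [/= sf2 D2]] CC'.
have [/Cu_pair_inj -> //|[C0 le0]] := Cu_pair_le CC'.
move=> a [r [s [/(D1 C').2 - /(_ C0 0) r0 /(D2 C').2 - /(_ C0 0) s0 /=]]].
(* Only the coefficients of degree 0 matter. They lie in [f1] and [f2] at the pair of exits of [C'],
   hence in their values at [Cu_pair C], which are the contractions of [g1 C] and [g2 C]. *)
move=> /(congr1 (fun t : laurent R => t 0%R)); rewrite laurent_addE laurentCE eqxx => ->.
rewrite laurentCD; exists (laurentC (r 0%R)), (laurentC (s 0%R)); split=> //.
  have /= : ideal_set (f1 (Cu_pair C)) (r 0%R) by apply: saturated_fun_anti le0 _ _.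
  by rewrite -(D1 C).1.
have /= : ideal_set (f2 (Cu_pair C)) (s 0%R) by apply: saturated_fun_anti le0 _ _.
by rewrite -(D2 C).1.
Qed.

(** Convertible to the function saturated in [D_join], so [saturationP] applies to it directly. *)
Definition D_join_base p q : admissible_nz E -> ideal R := fun x =>
  ideal_add (ideal_add ((sval p).1 x) ((sval q).1 x))
    (G_plus (sval p).2 (sval q).2 x).

Lemma D_join_Cu_pair p q (C : Cu E) :
  (D_join (sval p) (sval q)).1 (Cu_pair C) =
  ideal_contract (ideal_add ((sval p).2 C) ((sval q).2 C)).
Proof.
set J := ideal_contract _.
have [_ hsat satmin] := saturationP (D_join_base p q).
apply: ideal_eq; apply/seteqP; split; last first.
  apply: subset_trans (hsat _); rewrite /D_join_base G_plus_Cu_pair; exact: ideal_addr.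
(* The step function takes the value [J] at the cycle's own pair, so minimality of the saturation
   gives the bound once the step function dominates [D_join_base]. *)
have PJ : step_fun (Cu_pair C) J (Cu_pair C) `<=` J.
  by move=> a; rewrite /step_fun; case: pselect => // -[]; apply: adm_le_refl.
apply: subset_trans PJ; apply: satmin; first exact: step_fun_saturated.
have [sf1 D1] := svalP p; have [sf2 D2] := svalP q.
move=> x; rewrite /step_fun; case: pselect => [Px|//].
apply: ideal_add_sub; first apply: ideal_add_sub.
- apply: subset_trans (saturated_fun_anti sf1 Px) _; rewrite -(D1 C).1.
  by move=> a; apply: (@ideal_addl _ _ _ (laurentC a)).
- apply: subset_trans (saturated_fun_anti sf2 Px) _; rewrite -(D2 C).1.
  by move=> a; apply: (@ideal_addr _ _ _ (laurentC a)).
have [[C' C'x]|nC'] := pselect (exists C', Cu_pair C' = x).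
  by rewrite -C'x in Px *; rewrite G_plus_Cu_pair; apply: Cu_pair_le_contract.
by rewrite /G_plus; case: pselect => // _ _ ->; apply: ideal0.
Qed.

Lemma D_join_in_D p q : in_D (D_join (sval p) (sval q)).
Proof.
have [sat hsat _] := saturationP (D_join_base p q).
split=> // C; split=> [|C0]; first by rewrite D_join_Cu_pair.
have [_ /(_ C)[_ /(_ C0) Dp]] := svalP p.
have [_ /(_ C)[_ /(_ C0) Dq]] := svalP q.
(* The coefficient condition is checked degree by degree, the saturation being above the sum of the
   first components. *)
move=> _ [r [s [/Dp Dr /Dq Ds ->]]] i; rewrite laurent_addE.
by apply/hsat/ideal_addl; exists (r i), (s i).
Qed.

Lemma D_meet_in_D p q : in_D (D_meet (sval p) (sval q)).
Proof.
have [sp Dp] := svalP p; have [sq Dq] := svalP q; split=> /=.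
  move=> I x y xy; apply: ideal_eq; rewrite /= (sp _ _ _ xy) (sq _ _ _ xy).
  apply/seteqP; split=> a.
    by move=> [pa qa] _ [i _ <-]; split; [apply: pa|apply: qa]; exists i.
  by move=> pqa; split=> _ [i _ <-];
    have [] : ideal_set (ideal_cap ((sval p).1 (x i)) ((sval q).1 (x i))) a
      by apply: pqa; exists i.
move=> C; split=> [|C0 r [pr qr] i].
  by apply: ideal_eq; rewrite /= -(Dp C).1 -(Dq C).1.
by split; [apply: (Dp C).2|apply: (Dq C).2].
Qed.

Lemma D_le_order : Relation_Definitions.order (D_set E R) (@D_le E R).
Proof.
split=> [p|p q r [pq1 pq2] [qr1 qr2]|p q [pq1 pq2] [qp1 qp2]].
- by split=> ?.
- split=> ?; first exact: subset_trans (pq1 _) (qr1 _).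
  exact: subset_trans (pq2 _) (qr2 _).
apply: eq_sig_hprop => [? ? ?|]; first exact: Prop_irrelevance.
rewrite [LHS]surjective_pairing [RHS]surjective_pairing.
by congr pair; apply: funext => ?; apply: ideal_eq; apply/seteqP.
Qed.

Lemma D_meet_glb p q (m : D_set E R) : sval m = D_meet (sval p) (sval q) ->
  is_glb (@D_le E R) [set p; q] m.
Proof.
move=> mE; split=> [_ [] ->|b lb]; rewrite /D_le mE.
- by split=> ? ? [].
- by split=> ? ? [].
have [bp1 bp2] := lb p (or_introl erefl).
have [bq1 bq2] := lb q (or_intror erefl).
by split=> ? ? ?; split; [apply: bp1|apply: bq1|apply: bp2|apply: bq2].
Qed.

Lemma D_join_lub p q (j : D_set E R) : sval j = D_join (sval p) (sval q) ->
  is_lub (@D_le E R) [set p; q] j.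
Proof.
move=> jE; rewrite /is_lub /D_le jE.
have [_ hsat satmin] := saturationP (D_join_base p q).
split=> [_ [] ->|b ub].
- split=> ? ? ?; last exact: ideal_addl.
  by apply/hsat/ideal_addl/ideal_addl.
- split=> ? ? ?; last exact: ideal_addr.
  by apply/hsat/ideal_addl/ideal_addr.
have [pb1 pb2] := ub p (or_introl erefl).
have [qb1 qb2] := ub q (or_intror erefl).
have [sb Db] := svalP b.
have g_le C : ideal_add ((sval p).2 C) ((sval q).2 C) `<=` (sval b).2 C.
  exact: ideal_add_sub.
split=> //; apply: satmin => // x.
apply: ideal_add_sub; first exact: ideal_add_sub.
have [[C <-]|nC] := pselect (exists C, Cu_pair C = x).
  (* At a cycle, the bound on [G_plus] follows by contracting [g_le], as the first component of [b]
     at this pair is the contraction of its second. *)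
  rewrite G_plus_Cu_pair -(Db C).1 => a.
  exact: (g_le C (laurentC a)).
by rewrite /G_plus; case: pselect => // _ _ ->; apply: ideal0.
Qed.

End Lattice.

Theorem proposition6p16 (E : digraph) (R : comPzRingType) :
  Relation_Definitions.order (D_set E R) (@D_le E R) /\
  forall p q : D_set E R,
    (exists m : D_set E R, sval m = D_meet (sval p) (sval q) /\
       is_glb (@D_le E R) [set p; q] m) /\
    (exists j : D_set E R, sval j = D_join (sval p) (sval q) /\
       is_lub (@D_le E R) [set p; q] j).
Proof.
split=> [|p q]; first exact: D_le_order.
split; [exists (exist _ _ (D_meet_in_D p q))|exists (exist _ _ (D_join_in_D p q))].
  by split=> //; apply: D_meet_glb.
by split=> //; apply: D_join_lub.
Qed.
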